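(* Let $G$ be a countable group such that the abelianization $G_{ab}=G/G'$ is a direct product of a free abelian group and a finite group. Then $G$ embeds in some $4$-generated subgroup $H$ of the Cartesian wreath product $G\ \mathrm{Wr}\ \mathbb{Z}^3$.
   Context: Countable means finite or countably infinite. $G'$ denotes the derived subgroup of $G$. A group is $k$-generated if it can be generated by $k$ elements (not necessarily distinct). $\mathbb{Z}^3$ is the free abelian group of rank $3$. For groups $A$ and $B$, let $D$ be the group of all functions $f:B\to A$ with pointwise multiplication. $B$ acts on $D$ by $f^b(x)=f(bx)$ for $f\in D$, $b,x\in B$. The associated semidirect product $D\rtimes B$ (in which $b^{-1}fb=f^b$) is the Cartesian wreath product $A\ \mathrm{Wr}\ B$. *)

(* Defs.v *)
From HB Require Import structures.
From mathcomp Require Import all_boot all_order all_algebra fingroup.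
From mathcomp Require Import boolp classical_sets cardinality.
From mathcomp Require Import freeg.

Set Implicit Arguments.
Unset Strict Implicit.
Unset Printing Implicit Defensive.

Local Open Scope classical_set_scope.
Local Open Scope group_scope.

(* The library's {group gT} and <<A>> are only available for finite groups. *)
Definition is_subgroup (G : groupType) (H : set G) : Prop :=
  group_closed [in H].

Definition generated (G : groupType) (S : set G) : set G :=
  smallest (@is_subgroup G) S.

Definition derived (G : groupType) : set G :=
  generated [set [~ x, y] | x in [set: G] & y in [set: G]].

(* A k-tuple may have repeated entries. *)
Definition generated_by_k (G : groupType) (k : nat) (H : set G) : Prop :=
  exists s : k.-tuple G, H = generated [set` s].

Definition isomorphic (G H : groupType) : Prop :=
  exists f : {multiplicative G -> H}, bijective f.

Definition embeds_in (G W : groupType) (H : set W) : Prop :=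
  exists f : {multiplicative G -> W}, injective f /\ range f `<=` H.

(* {freeg K} is the group of finitely supported formal sums of elements of K
   with coefficients in int; Algebra.to_multiplicative only rewrites an
   additive group multiplicatively. *)
Definition free_abelian (A : groupType) : Prop :=
  exists K : choiceType, isomorphic A (Algebra.to_multiplicative {freeg K}).

Lemma is_subgroupP (G : groupType) (H : set G) :
  is_subgroup H <->
  [/\ H 1, (forall x y, H x -> H y -> H (x * y)) & forall x, H x -> H x^-1].
Proof.
split=> [[H1 HF]|[H1 HM HV]]; last first.
  split; first exact/mem_set.
  by move=> x y /set_mem Hx /set_mem Hy; apply/mem_set/HM => //; apply: HV.
have HV x : H x -> H x^-1.
  move=> Hx; rewrite -div1g; apply: set_mem; apply: HF => //; exact: mem_set.
split=> //; first exact: set_mem.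
move=> x y Hx Hy; rewrite -[y]invgK; apply: set_mem.
by apply: HF; apply: mem_set => //; apply: HV.
Qed.

Lemma generated_subgroup (G : groupType) (S : set G) :
  is_subgroup (generated S).
Proof.
apply/is_subgroupP; split.
- by move=> H [/is_subgroupP[]].
- move=> x y Hx Hy H HS; have [/is_subgroupP[_ HM _] _] := HS.
  by apply: HM; [apply: Hx | apply: Hy].
- move=> x Hx H HS; have [/is_subgroupP[_ _ HV] _] := HS.
  by apply: HV; apply: Hx.
Qed.

Lemma derived_commg (G : groupType) (x y : G) : derived [~ x, y].
Proof. by move=> H [_]; apply; exists x => //; exists y. Qed.

Lemma derivedM (G : groupType) (x y : G) :
  derived x -> derived y -> derived (x * y).
Proof.
have /is_subgroupP[_ + _] := @generated_subgroup G
  [set [~ x, y] | x in [set: G] & y in [set: G]].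
exact.
Qed.

Lemma derivedV (G : groupType) (x : G) : derived x -> derived x^-1.
Proof.
have /is_subgroupP[_ _] := @generated_subgroup G
  [set [~ x, y] | x in [set: G] & y in [set: G]].
exact.
Qed.

Lemma derived1 (G : groupType) : @derived G 1.
Proof. by rewrite -(commgg (1 : G)); apply: derived_commg. Qed.

Lemma derivedJ (G : groupType) (x y : G) : derived x -> derived (x ^ y).
Proof.
move=> dx; have -> : x ^ y = x * [~ x, y] by rewrite commgEl mulVKg.
exact: derivedM dx (derived_commg x y).
Qed.

(* Equality of the left cosets of x and y modulo the derived subgroup. *)
Definition derived_rel (G : groupType) : rel G :=
  fun x y => `[< derived (x^-1 * y) >].

Lemma derived_rel_refl (G : groupType) : reflexive (@derived_rel G).
Proof. by move=> x; apply/asboolP; rewrite mulVg; apply: derived1. Qed.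

Lemma derived_rel_sym (G : groupType) : symmetric (@derived_rel G).
Proof.
suff sub (x y : G) : derived_rel x y -> derived_rel y x.
  by move=> x y; apply/idP/idP; apply: sub.
by move=> /asboolP/derivedV; rewrite invgM invgK => ?; apply/asboolP.
Qed.

Lemma derived_rel_trans (G : groupType) : transitive (@derived_rel G).
Proof.
move=> y x z /asboolP dxy /asboolP dyz; apply/asboolP.
by have := derivedM dxy dyz; rewrite -mulgA mulVKg.
Qed.

Canonical derived_equiv (G : groupType) :=
  EquivRel (@derived_rel G) (@derived_rel_refl G) (@derived_rel_sym G)
    (@derived_rel_trans G).

Definition abelianization (G : groupType) : Type :=
  {eq_quot (derived_equiv G)}%qT.

HB.instance Definition _ (G : groupType) := Choice.on (abelianization G).
HB.instance Definition _ (G : groupType) := EqQuotient.on (abelianization G).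

Definition ab_pi (G : groupType) (x : G) : abelianization G :=
  \pi_(abelianization G)%qT x.

Lemma ab_piP (G : groupType) (x y : G) :
  ab_pi x = ab_pi y <-> derived (x^-1 * y).
Proof.
split=> [/eqP|d].
  by rewrite /ab_pi eqquotE => /asboolP.
by apply/eqP; rewrite /ab_pi eqquotE; apply/asboolP.
Qed.

Definition ab_repr (G : groupType) (u : abelianization G) : G :=
  generic_quotient.repr u.

Lemma ab_reprK (G : groupType) (u : abelianization G) : ab_pi (ab_repr u) = u.
Proof. exact: reprK. Qed.

Definition ab_mul (G : groupType) (u v : abelianization G) :=
  ab_pi (ab_repr u * ab_repr v).
Definition ab_inv (G : groupType) (u : abelianization G) :=
  ab_pi (ab_repr u)^-1.

Lemma ab_mulE (G : groupType) (x y : G) :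
  ab_mul (ab_pi x) (ab_pi y) = ab_pi (x * y).
Proof.
apply/ab_piP; have /ab_piP dx := ab_reprK (ab_pi x).
have /ab_piP dy := ab_reprK (ab_pi y).
set x' := ab_repr (ab_pi x) in dx *; set y' := ab_repr (ab_pi y) in dy *.
have -> : (x' * y')^-1 * (x * y) = (x'^-1 * x) ^ y' * (y'^-1 * y).
  by rewrite conjgE invgM !mulgA mulgK.
exact: derivedM (derivedJ _ dx) dy.
Qed.

Lemma ab_invE (G : groupType) (x : G) : ab_inv (ab_pi x) = ab_pi x^-1.
Proof.
apply/ab_piP; have /ab_piP dx := ab_reprK (ab_pi x).
set x' := ab_repr (ab_pi x) in dx *.
have -> : x'^-1^-1 * x^-1 = ((x'^-1 * x)^-1) ^ x^-1.
  by rewrite conjgE invgM !invgK !mulgA divgg mul1g.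
exact: derivedJ (derivedV dx).
Qed.

Lemma ab_mulA (G : groupType) : associative (@ab_mul G).
Proof.
move=> u v w; rewrite -(ab_reprK u) -(ab_reprK v) -(ab_reprK w).
by rewrite !ab_mulE mulgA.
Qed.
Lemma ab_mul1g (G : groupType) : left_id (ab_pi 1) (@ab_mul G).
Proof. by move=> u; rewrite -(ab_reprK u) ab_mulE mul1g. Qed.
Lemma ab_mulg1 (G : groupType) : right_id (ab_pi 1) (@ab_mul G).
Proof. by move=> u; rewrite -(ab_reprK u) ab_mulE mulg1. Qed.
Lemma ab_mulVg (G : groupType) :
  left_inverse (ab_pi 1) (@ab_inv G) (@ab_mul G).
Proof. by move=> u; rewrite -(ab_reprK u) ab_invE ab_mulE mulVg. Qed.
Lemma ab_mulgV (G : groupType) :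
  right_inverse (ab_pi 1) (@ab_inv G) (@ab_mul G).
Proof. by move=> u; rewrite -(ab_reprK u) ab_invE ab_mulE mulgV. Qed.

HB.instance Definition _ (G : groupType) :=
  isGroup.Build (abelianization G)
    (@ab_mulA G) (@ab_mul1g G) (@ab_mulg1 G) (@ab_mulVg G) (@ab_mulgV G).

Lemma ab_piM (G : groupType) : {morph @ab_pi G : x y / x * y}.
Proof. by move=> x y; rewrite -ab_mulE. Qed.
Lemma ab_pi_surj (G : groupType) (u : abelianization G) :
  exists x, ab_pi x = u.
Proof. by exists (ab_repr u); apply: ab_reprK. Qed.
Lemma ab_pi_ker (G : groupType) (x : G) : ab_pi x = 1 <-> derived x.
Proof.
by split=> [/esym/ab_piP|dx]; [|apply/esym/ab_piP]; rewrite invg1 mul1g.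
Qed.

(* The Cartesian wreath product A Wr B. The pair (f, b) stands for the product
   f b, and the action f^b(x) = f(b x) is a right action, so that
   f b g c = f g^(b^-1) (b c); see wr_conj. *)
Record wreath (A B : groupType) := Wreath { wr_fun : B -> A; wr_top : B }.

Definition wreath_pair (A B : groupType) (w : wreath A B) : (B -> A) * B :=
  (wr_fun w, wr_top w).
Definition pair_wreath (A B : groupType) (p : (B -> A) * B) : wreath A B :=
  Wreath p.1 p.2.
Lemma wreath_pairK (A B : groupType) :
  cancel (@wreath_pair A B) (@pair_wreath A B).
Proof. by case. Qed.

HB.instance Definition _ (A B : groupType) :=
  Choice.copy (wreath A B) (can_type (@wreath_pairK A B)).

Definition wr_act (A B : groupType) (f : B -> A) (b : B) : B -> A :=
  fun x => f (b * x).

Definition wr_one (A B : groupType) : wreath A B := Wreath (fun=> 1) 1.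
Definition wr_mul (A B : groupType) (v w : wreath A B) : wreath A B :=
  Wreath (fun x => wr_fun v x * wr_act (wr_fun w) (wr_top v)^-1 x)
         (wr_top v * wr_top w).
Definition wr_inv (A B : groupType) (w : wreath A B) : wreath A B :=
  Wreath (fun x => (wr_act (wr_fun w) (wr_top w) x)^-1) (wr_top w)^-1.

Lemma wr_mulA (A B : groupType) : associative (@wr_mul A B).
Proof.
move=> [f b] [g c] [h d]; rewrite /wr_mul /wr_act /=; congr Wreath.
  by apply/funext => x; rewrite invgM !mulgA.
by rewrite mulgA.
Qed.
Lemma wr_mul1g (A B : groupType) : left_id (@wr_one A B) (@wr_mul A B).
Proof.
move=> [f b]; rewrite /wr_mul /wr_act /= mul1g; congr Wreath.
by apply/funext => x; rewrite invg1 !mul1g.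
Qed.
Lemma wr_mulg1 (A B : groupType) : right_id (@wr_one A B) (@wr_mul A B).
Proof.
move=> [f b]; rewrite /wr_mul /wr_act /= mulg1; congr Wreath.
by apply/funext => x; rewrite mulg1.
Qed.
Lemma wr_mulVg (A B : groupType) :
  left_inverse (@wr_one A B) (@wr_inv A B) (@wr_mul A B).
Proof.
move=> [f b]; rewrite /wr_mul /wr_one /wr_act /= mulVg; congr Wreath.
by apply/funext => x; rewrite invgK mulVg.
Qed.
Lemma wr_mulgV (A B : groupType) :
  right_inverse (@wr_one A B) (@wr_inv A B) (@wr_mul A B).
Proof.
move=> [f b]; rewrite /wr_mul /wr_one /wr_inv /wr_act /= mulgV; congr Wreath.
by apply/funext => x; rewrite mulVKg mulgV.
Qed.

HB.instance Definition _ (A B : groupType) :=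
  isGroup.Build (wreath A B)
    (@wr_mulA A B) (@wr_mul1g A B) (@wr_mulg1 A B)
    (@wr_mulVg A B) (@wr_mulgV A B).

Definition wr_in_base (A B : groupType) (f : B -> A) : wreath A B :=
  Wreath f 1.
Definition wr_in_top (A B : groupType) (b : B) : wreath A B :=
  Wreath (fun=> 1) b.

Lemma wr_in_baseM (A B : groupType) (f g : B -> A) :
  wr_in_base (fun x => f x * g x) = wr_in_base f * wr_in_base g.
Proof.
rewrite /mul /= /wr_mul /wr_act /= mul1g; congr Wreath.
by apply/funext => x; rewrite invg1 mul1g.
Qed.
Lemma wr_in_topM (A B : groupType) (b c : B) :
  wr_in_top A (b * c) = wr_in_top A b * wr_in_top A c.
Proof.
rewrite {2}/mul /= /wr_mul /wr_act /=; congr Wreath.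
by apply/funext => x; rewrite mulg1.
Qed.
Lemma wr_decomp (A B : groupType) (w : wreath A B) :
  w = wr_in_base (wr_fun w) * wr_in_top A (wr_top w).
Proof.
case: w => f b; rewrite /mul /= /wr_mul /wr_act /= mul1g; congr Wreath.
by apply/funext => x; rewrite mulg1.
Qed.
Lemma wr_conj (A B : groupType) (f : B -> A) (b : B) :
  (wr_in_top A b)^-1 * wr_in_base f * wr_in_top A b =
  wr_in_base (fun x => f (b * x)).
Proof.
rewrite /mul /inv /= /wr_mul /wr_inv /wr_act /= mulg1 mulVg; congr Wreath.
by apply/funext => x; rewrite invg1 mul1g mulg1 invgK.
Qed.

Definition Z3 : groupType := Algebra.to_multiplicative 'rV[int]_3.

(* Main.v *)
Require Import Defs.
From mathcomp Require Import all_boot all_order all_algebra fingroup.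
From mathcomp Require Import boolp classical_sets cardinality.
From mathcomp Require Import freeg zify.
From HB Require Import structures.

(** Write points of Z^3 as (a, b, c) and call the set of points with a given c
    a plane. All the information on G is packed into one function f on Z^3, the
    seed, which is trivial off the planes c = 2^i; H is generated by f and the
    three unit translations. The seed is designed to put three kinds of functions
    into H.

    Commutators. The planes with i >= k are constant and their values exhaust G.
    A nonzero difference of two powers of 2 determines both powers, so two
    translates of f that bring the planes i and j, i <> j, to c = 0 are never
    both nontrivial at a point off that plane. Their commutator is therefore the
    slab of [x, y], the function equal to [x, y] on c = 0 and to 1 elsewhere.
    Hence H contains the slabs of all elements of G' (mem_slab_derived).

    The finite part. Let F be the finite factor of the abelianization, k = #|F|,
    and let y_0, ..., y_(k-1) lift its elements. Slabs of the y_i have to be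
    separated from each other by operators in Z[Z^3]. Two translations achieve
    this: if n_m is a polynomial function of degree m with m-th difference 1,
    plane i < k carries y_i ^ (n_i(a) n_(k-i)(b)), and taking j differences in a
    and k - j in b kills every plane except the j-th, which becomes constantly
    y_j. This works because i and k - i cannot both be at least j and k - j
    unless i = j; the constant planes die as k > 0. See mem_slab_seed.

    The free part. Let x_i lift a basis of the free factor. The translate w_i of
    f that brings a plane with value x_i to c = 0 is not a slab, but at any point
    off c = 0 at most one w_i is nontrivial. So for each such point there is a
    homomorphism from the free abelian factor to G sending the i-th basis element
    to the value of w_i (freeg_hom_single): the values commute for a trivial
    reason, and a free abelian group imposes no other relation.

    Now send x in G to the function Psi x that equals x on the plane c = 0 and is
    given at every other point by the homomorphism just described, applied to the
    free part of x. This is an injective homomorphism to the base group. It maps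
    x_i to w_i, each y_j to its slab and each element of G' to its slab, all of
    which are in H, and these elements generate G
    (shift_invariant_embedding). *)

Set Implicit Arguments.
Unset Strict Implicit.
Unset Printing Implicit Defensive.

(** * Integer powers and homomorphisms out of a free abelian group *)

Section IntegerPowers.
Local Open Scope group_scope.
Variable G : groupType.
Implicit Types (x : G) (m n : int).

Definition zpow x n : G :=
  match n with Posz p => x ^+ p | Negz p => x ^- p.+1 end.

Lemma zpow_succ x n : zpow x (n + 1)%R = zpow x n * x.
Proof.
case: n => [p|[|p]].
- have -> : (Posz p + 1 = Posz p.+1)%R by lia.
  by rewrite /= expgSr.
- by rewrite /= expg1 mulVg.
have -> : (Negz p.+1 + 1 = Negz p)%R by lia.
by rewrite /= [x ^+ p.+2]expgS invgM mulgKV.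
Qed.

(** Off-by-one bookkeeping on the two constructors of int is confined to
    zpow_succ; the exponent law follows by induction on one exponent. *)
Lemma zpowD x m n : zpow x (m + n)%R = zpow x m * zpow x n.
Proof.
elim/int_rect: n => [|n IHn|n IHn]; first by rewrite GRing.addr0 mulg1.
- have -> : (m + n.+1%:Z = (m + n%:Z) + 1)%R by lia.
  have -> : (n.+1%:Z = n%:Z + 1)%R by lia.
  by rewrite !zpow_succ IHn mulgA.
apply: (mulIg x); rewrite -mulgA -!zpow_succ.
have -> : (m - n.+1%:Z + 1 = m - n%:Z)%R by lia.
by have -> : (- n.+1%:Z + 1 = - n%:Z)%R by lia.
Qed.

Lemma zpow1 x : zpow x 1%R = x. Proof. exact: expg1. Qed.

Lemma zpowN x n : zpow x (- n)%R = (zpow x n)^-1.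
Proof. by apply: (mulgI (zpow x n)); rewrite -zpowD GRing.subrr mulgV. Qed.

(** A family with at most one nontrivial value commutes, so it extends from the
    basis to the free abelian group: read off one coefficient as an exponent. *)
Lemma freeg_hom_single (K : choiceType) (w : K -> G) :
    (forall i j, i <> j -> w i = 1 \/ w j = 1) ->
  exists phi : {freeg K} -> G,
    (forall a b, phi (a + b)%R = phi a * phi b) /\
    (forall i, phi << 1%R *g i >> = w i).
Proof.
move=> w_single.
have [[i wi]|w1] := pselect (exists i, w i <> 1); last first.
  exists (fun=> 1); split=> [a b|i]; first by rewrite mulg1.
  by apply: contrapT => wi; apply: w1; exists i => wi1; apply: wi.
exists (fun a => zpow (w i) (coeff i a)); split=> [a b|j].
  by rewrite coeffD zpowD.
rewrite coeffU GRing.mul1r; have [->|ji] := eqVneq j i; first exact: zpow1.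
by case: (w_single j i (elimN eqP ji)).
Qed.

End IntegerPowers.

(** * Discrete antiderivatives *)

Section FiniteDifferences.
Local Open Scope ring_scope.

Definition diff (h : int -> int) (n : int) : int := h (n + 1) - h n.

(** The antiderivative vanishing at 0; both signs are needed because a
    slab extends in both directions. *)
Definition antidiff (h : int -> int) (n : int) : int :=
  match n with
  | Posz p => \sum_(i < p) h i%:Z
  | Negz p => - \sum_(i < p.+1) h (Negz i)
  end.

(** On nonnegative n, newton m n is the binomial coefficient of n over m. *)
Definition newton (m : nat) : int -> int := iter m antidiff (fun=> 1).

Lemma antidiffK h : diff (antidiff h) = h.
Proof.
apply/funext => -[p|[|p]]; rewrite /diff.
- have -> : Posz p + 1 = Posz p.+1 by lia.
  by rewrite /= big_ord_recr /= GRing.addrAC GRing.subrr GRing.add0r.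
- by rewrite /= big_ord_recl !big_ord0 GRing.addr0 GRing.opprK GRing.add0r.
have -> : Negz p.+1 + 1 = Negz p by lia.
by rewrite /= [in X in _ - X]big_ord_recr /= GRing.opprK GRing.addKr.
Qed.

Lemma iter_diff_newton j m :
  iter j diff (newton m) = if (j <= m)%N then newton (m - j) else fun=> 0.
Proof.
elim: j m => [|j IHj] m; first by rewrite subn0.
rewrite iterS IHj; have [ltjm|lemj|->] := ltngtP j m; last first.
- by rewrite subnn; apply/funext => n; rewrite /diff GRing.subrr.
- by apply/funext => n; rewrite /diff GRing.subrr.
by rewrite -[(m - j)%N]prednK ?subn_gt0 // antidiffK subnS.
Qed.

End FiniteDifferences.

(** * Functions supported on sparse parallel planes *)

Section Planes.
Local Open Scope group_scope.
Variable G : groupType.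

(** Otherwise 2^j would be the only term not divisible by 2^(j+1). *)
Lemma sum_pow2_min i j k l :
  j < i -> j < k -> j < l -> 2 ^ i + 2 ^ l <> 2 ^ k + 2 ^ j.
Proof.
move=> ltji ltjk ltjl eqp.
have : 2 ^ j.+1 %| 2 ^ k + 2 ^ j by rewrite -eqp dvdn_add ?dvdn_exp2l.
rewrite dvdn_addr; last exact: dvdn_exp2l.
by rewrite dvdn_Pexp2l // ltnn.
Qed.

(** The equation is 2^i - 2^j = 2^k - 2^l, written without subtraction: a nonzero
    difference of powers of 2 determines both. The smallest exponent must occur
    on both sides, and cancelling it leaves the other one. *)
Lemma sub_pow2_inj i j k l :
  i <> j -> 2 ^ i + 2 ^ l = 2 ^ k + 2 ^ j -> i = k /\ j = l.
Proof.
wlog ltji : i j k l / j < i => [IH neqij eqp|_ eqp].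
  have [ltij|ltji|//] := ltngtP i j; last exact: IH.
  by have [||-> ->] := IH j i l k ltij; [exact/nesym | lia|].
have ltlk : l < k.
  move: ltji; rewrite -(ltn_exp2l _ _ (isT : 1 < 2)).
  by rewrite -(ltn_exp2l l _ (isT : 1 < 2)); lia.
have [ltjl|ltlj|eqjl] := ltngtP j l.
- by case: (sum_pow2_min ltji (ltn_trans ltjl ltlk) ltjl eqp).
- by case: (sum_pow2_min ltlk (ltn_trans ltlj ltji) ltlj); rewrite eqp.
split=> //; apply/eqP; rewrite -(eqn_exp2l _ _ (isT : 1 < 2)).
by move: eqp; rewrite eqjl => /addIn ->.
Qed.

(** The function on Z^3 that carries s i on the plane c = 2^i. *)
Definition planes (s : nat -> int -> int -> G) (a b c : int) : G :=
  if c is Posz n then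
    let i := trunc_log 2 n in if n == (2 ^ i)%N then s i a b else 1
  else 1.

Lemma planesE s a b i : planes s a b (Posz (2 ^ i)) = s i a b.
Proof. by rewrite /planes trunc_expnK // eqxx. Qed.

Lemma planesP (c : int) :
  (exists i : nat, c = Posz (2 ^ i)%N) \/ (forall s a b, planes s a b c = 1).
Proof.
case: c => [n|n]; last by right.
have [eqn|/negPf neqn] := eqVneq n (2 ^ trunc_log 2 n)%N.
  by left; exists (trunc_log 2 n); rewrite -eqn.
by right=> s a b; rewrite /planes /= neqn.
Qed.

(** The reason for placing the planes at powers of 2: translates that bring
    different planes to c = 0 overlap nowhere else. *)
Lemma planes_shift_disjoint s (i j : nat) (a b c : int) : i <> j -> c <> 0%R ->
  planes s a b (c + Posz (2 ^ i)%N)%R = 1 \/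
  planes s a b (c + Posz (2 ^ j)%N)%R = 1.
Proof.
move=> neqij c0.
have [[l eql]|->] := planesP (c + Posz (2 ^ i)%N)%R; last by left.
have [[m eqm]|->] := planesP (c + Posz (2 ^ j)%N)%R; last by right.
have [|eqim eqjl] := @sub_pow2_inj i j l m neqij; first lia.
by case: c0; move: eql; rewrite eqim; lia.
Qed.

End Planes.

(** * Shift-invariant groups of functions on the integer lattice *)

Section Lattice.
Local Open Scope group_scope.
Variable G : groupType.
Implicit Types (u v : int -> int -> int -> G) (z : nat -> G).

(** What remains of a subgroup of the wreath product containing all of Z^3 when
    only its intersection with the base group is considered. *)
Record shift_invariant_group (P : (int -> int -> int -> G) -> Prop) : Prop := {
  shinvM : forall u v, P u -> P v -> P (fun a b c => u a b c * v a b c);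
  shinvV : forall u, P u -> P (fun a b c => (u a b c)^-1);
  shinv_shift : forall u i j k, P u ->
    P (fun a b c => u (a + i)%R (b + j)%R (c + k)%R)
}.

Definition shift3 u (k : int) (a b c : int) : G := u a b (c + k)%R.
Definition diff1 u (a b c : int) : G := (u a b c)^-1 * u (a + 1)%R b c.
Definition diff2 u (a b c : int) : G := (u a b c)^-1 * u a (b + 1)%R c.

Lemma mem_shift3 P u k :
  shift_invariant_group P -> P u -> P (shift3 u k).
Proof.
move=> Pgrp /(shinv_shift Pgrp 0 0 k); congr P.
by apply/funext => a; apply/funext => b; rewrite !GRing.addr0.
Qed.

Lemma mem_diff1 P u : shift_invariant_group P -> P u -> P (diff1 u).
Proof.
move=> Pgrp Pu; apply: (shinvM Pgrp); first exact: shinvV.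
have /(shinv_shift Pgrp 1 0 0) := Pu; congr P.
by apply/funext => a; apply/funext => b; apply/funext => c;
   rewrite !GRing.addr0.
Qed.

Lemma mem_diff2 P u : shift_invariant_group P -> P u -> P (diff2 u).
Proof.
move=> Pgrp Pu; apply: (shinvM Pgrp); first exact: shinvV.
have /(shinv_shift Pgrp 0 1 0) := Pu; congr P.
by apply/funext => a; apply/funext => b; apply/funext => c;
   rewrite !GRing.addr0.
Qed.

(** On each plane all values are powers of one element, so the difference
    operators act on the exponents, where they are additive. *)
Definition zplanes z (h l : nat -> int -> int) : int -> int -> int -> G :=
  planes (fun i a b => zpow (z i) (h i a * l i b)%R).

Lemma diff1_zplanes z h l : diff1 (zplanes z h l) = zplanes z (diff \o h) l.
Proof.
apply/funext => a; apply/funext => b; apply/funext => c.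
rewrite /diff1 /zplanes; have [[i ->]|out] := planesP G c; last first.
  by rewrite !out mulVg.
by rewrite !planesE -zpowN -zpowD /= /diff GRing.mulrBl GRing.addrC.
Qed.

Lemma diff2_zplanes z h l : diff2 (zplanes z h l) = zplanes z h (diff \o l).
Proof.
apply/funext => a; apply/funext => b; apply/funext => c.
rewrite /diff2 /zplanes; have [[i ->]|out] := planesP G c; last first.
  by rewrite !out mulVg.
by rewrite !planesE -zpowN -zpowD /= /diff GRing.mulrBr GRing.addrC.
Qed.

Lemma mem_iter_diff P z h l i j : shift_invariant_group P ->
  P (zplanes z h l) -> P (zplanes z (iter i diff \o h) (iter j diff \o l)).
Proof.
move=> Pgrp Pz; elim: i => [|i IHi].
  elim: j => [|j IHj] //.
  by have := mem_diff2 Pgrp IHj; rewrite diff2_zplanes.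
by have := mem_diff1 Pgrp IHi; rewrite diff1_zplanes.
Qed.

(** The elements of G embed in the base group as functions supported on a plane
    rather than at a point: a slab is annihilated by differences in a and by
    differences in b, which makes the slabs of finitely many elements
    separable. *)
Definition slab (g : G) (a b c : int) : G := if c == 0%R then g else 1.

Lemma slabM g h : (fun a b c => slab g a b c * slab h a b c) = slab (g * h).
Proof.
apply/funext => a; apply/funext => b; apply/funext => c.
by rewrite /slab; case: ifP => _ //; rewrite mulg1.
Qed.

Lemma slabV g : (fun a b c => (slab g a b c)^-1) = slab g^-1.
Proof.
apply/funext => a; apply/funext => b; apply/funext => c.
by rewrite /slab; case: ifP => _ //; rewrite invg1.
Qed.

(** Bidegree of the exponent on plane i: total degree k for i < k, and constant
    planes from k on. *)
Definition deg1 (k i : nat) : nat := if i < k then i else 0.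
Definition deg2 (k i : nat) : nat := if i < k then k - i else 0.

Definition seed (k : nat) z : int -> int -> int -> G :=
  zplanes z (newton \o deg1 k) (newton \o deg2 k).

Lemma seed_const k z i a b : k <= i -> seed k z a b (Posz (2 ^ i)) = z i.
Proof.
move=> leki; rewrite /seed /zplanes planesE /= /deg1 /deg2 ltnNge leki /=.
exact: zpow1.
Qed.

(** Taking j differences in a and k - j in b annihilates every plane whose
    bidegree does not dominate (j, k - j). Only plane j survives: the others
    below k have total degree k too, and those from k on are constant. *)
Lemma mem_slab_seed P k z j : shift_invariant_group P ->
  P (seed k z) -> j < k -> P (slab (z j)).
Proof.
move=> Pgrp /(mem_iter_diff j (k - j) Pgrp) + ltjk.
move=> /(mem_shift3 (Posz (2 ^ j)) Pgrp); congr P.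
apply/funext => a; apply/funext => b; apply/funext => c.
rewrite /shift3 /slab; have [->|/eqP c0] := eqVneq c 0%R.
  rewrite GRing.add0r /zplanes planesE /= /deg1 /deg2 ltjk.
  by rewrite !iter_diff_newton !leqnn !subnn; apply: zpow1.
rewrite /zplanes; have [[i eqi]|->//] := planesP G (c + Posz (2 ^ j))%R.
have neqij : i <> j by move=> eqij; apply: c0; move: eqi; rewrite eqij; lia.
rewrite eqi planesE /= /deg1 /deg2 !iter_diff_newton.
have [ltik|leki] := ltnP i k.
  have [ltji|ltij|eqji] := ltngtP j i; last by case: neqij.
    by have -> : (k - j <= k - i) = false by [lia]; rewrite /= GRing.mulr0.
  by rewrite /= GRing.mul0r.
have [eqj0|jgt0] := posnP j; last by rewrite leqNgt jgt0 GRing.mul0r.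
by rewrite eqj0 !subn0 [k <= 0]leqNgt (leq_ltn_trans _ ltjk) //= GRing.mulr0.
Qed.

(** The two translates meet only on c = 0, so their commutator is a slab. *)
Lemma mem_slab_commg P k z i j : shift_invariant_group P ->
  P (seed k z) -> k <= i -> k <= j -> i <> j -> P (slab [~ z i, z j]).
Proof.
move=> Pgrp Pz leki lekj neqij.
have Pi := mem_shift3 (Posz (2 ^ i)) Pgrp Pz.
have Pj := mem_shift3 (Posz (2 ^ j)) Pgrp Pz.
have := shinvM Pgrp (shinvV Pgrp Pi)
  (shinvM Pgrp (shinvV Pgrp Pj) (shinvM Pgrp Pi Pj)).
congr P; apply/funext => a; apply/funext => b; apply/funext => c.
rewrite /shift3 /slab; have [->|/eqP c0] := eqVneq c 0%R.
  by rewrite !GRing.add0r !seed_const // commgEl conjgE.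
rewrite /seed /zplanes.
set u := fun i a b => zpow _ _.
by have [->|->] := planes_shift_disjoint u a b neqij c0;
  rewrite ?invg1 ?mul1g ?mulg1 ?mulVg.
Qed.

(** The commutators of all pairs of elements generate G', without conjugating,
    because the constant planes exhaust G. *)
Lemma mem_slab_derived P k z g : shift_invariant_group P -> P (seed k z) ->
  (forall x, exists2 i, k <= i & z i = x) -> derived g -> P (slab g).
Proof.
move=> Pgrp Pz z_onto; move: g.
have P1 : P (slab 1).
  have := shinvM Pgrp Pz (shinvV Pgrp Pz); congr P.
  apply/funext => a; apply/funext => b; apply/funext => c.
  by rewrite mulgV /slab if_same.
apply: smallest_sub => [|_ [x _ [y _ <-]]] /=.
  apply/is_subgroupP; split=> // [x y Px Py|x Px].
    by have := shinvM Pgrp Px Py; rewrite slabM.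
  by have := shinvV Pgrp Px; rewrite slabV.
have [i leki <-] := z_onto x; have [j lekj <-] := z_onto y.
have [->|/eqP neqij] := eqVneq i j; first by rewrite commgg.
exact: (mem_slab_commg Pgrp Pz).
Qed.

(** Here theta and tau are the projections of G to the free and to the finite
    part of its abelianization. *)
Lemma shift_invariant_embedding (K : choiceType) (F : finGroupType)
    (theta : G -> {freeg K}) (tau : G -> F) k z P :
  shift_invariant_group P -> P (seed k z) ->
  (forall x, exists2 i, k <= i & z i = x) ->
  (forall e, exists2 j, j < k & theta (z j) = 0%R /\ tau (z j) = e) ->
  (forall x y, theta (x * y) = (theta x + theta y)%R) ->
  (forall x y, tau (x * y) = tau x * tau y) ->
  (forall i, exists x, theta x = << 1%R *g i >> /\ tau x = 1) ->
  (forall x, theta x = 0%R -> tau x = 1 -> derived x) ->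
  exists Psi : G -> int -> int -> int -> G,
    [/\ forall x y a b c, Psi (x * y) a b c = Psi x a b c * Psi y a b c,
        forall x, Psi x 0%R 0%R 0%R = x & forall x, P (Psi x)].
Proof.
move=> Pgrp Pz z_onto y_onto thetaM tauM basis ker.
have theta1 : theta 1 = 0%R.
  by apply: (GRing.addrI (theta 1)); rewrite -thetaM mulg1 GRing.addr0.
have thetaV x : theta x^-1 = (- theta x)%R.
  by apply: (GRing.addrI (theta x)); rewrite -thetaM mulgV GRing.subrr.
have tau1 : tau 1 = 1 by apply: (mulgI (tau 1)); rewrite -tauM !mulg1.
have tauV x : tau x^-1 = (tau x)^-1.
  by apply: (mulgI (tau x)); rewrite -tauM !mulgV.
have /choice[ix ixP] : forall i, exists n,
    [/\ k <= n, theta (z n) = << 1%R *g i >> & tau (z n) = 1].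
  move=> i; have [x [thx taux]] := basis i.
  by have [n lekn zn] := z_onto x; exists n; rewrite zn.
(* Distinct basis elements use distinct planes, as theta recovers the basis
   element from the plane. *)
have ix_inj i j : i <> j -> ix i <> ix j.
  move=> neqij eqij; have [_ thi _] := ixP i; have [_ thj _] := ixP j.
  apply: neqij; have := congr1 (coeff i) thi.
  rewrite eqij thj !coeffU eqxx !GRing.mul1r.
  by case: eqP => // ->.
pose w (p : int * int * int) i :=
  shift3 (seed k z) (Posz (2 ^ ix i)) p.1.1 p.1.2 p.2.
have /choice[phi phiP] : forall p, exists phi : {freeg K} -> G,
    (forall a b, phi (a + b)%R = phi a * phi b) /\
    (p.2 <> 0%R -> forall i, phi << 1%R *g i >> = w p i).
  move=> p; have [->|/eqP p0] := eqVneq p.2 0%R.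
    by exists (fun=> 1); split=> // a b; rewrite mulg1.
  have [|phi [phiM phiw]] := @freeg_hom_single G K (w p); last by exists phi.
  by move=> i j /ix_inj neqij; apply: planes_shift_disjoint.
have phi0 p : phi p 0%R = 1.
  have [phiM _] := phiP p.
  by apply: (mulgI (phi p 0%R)); rewrite -phiM GRing.addr0 mulg1.
pose Psi x a b c := if c == 0%R then x else phi (a, b, c) (theta x).
have PsiM x y : Psi (x * y) = (fun a b c => Psi x a b c * Psi y a b c).
  apply/funext => a; apply/funext => b; apply/funext => c; rewrite /Psi.
  by case: eqP => // _; rewrite thetaM; have [-> _] := phiP (a, b, c).
have PPsiM x y : P (Psi x) -> P (Psi y) -> P (Psi (x * y)).
  by move=> Px Py; rewrite PsiM; apply: shinvM.
have Psi1 : Psi 1 = fun a b c => 1.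
  apply/funext => a; apply/funext => b; apply/funext => c; rewrite /Psi.
  by case: eqP => // _; rewrite theta1 phi0.
have PsiV x : Psi x^-1 = (fun a b c => (Psi x a b c)^-1).
  apply/funext => a; apply/funext => b; apply/funext => c.
  apply: (mulgI (Psi x a b c)); rewrite mulgV.
  by have := congr1 (fun u => u a b c) (PsiM x x^-1); rewrite mulgV Psi1 => <-.
have PPsiV x : P (Psi x) -> P (Psi x^-1).
  by move=> Px; rewrite PsiV; apply: shinvV.
have Psi_slab x : theta x = 0%R -> Psi x = slab x.
  move=> thx; apply/funext => a; apply/funext => b; apply/funext => c.
  by rewrite /Psi thx phi0.
have Psi_ix i : P (Psi (z (ix i))).
  have := mem_shift3 (Posz (2 ^ ix i)) Pgrp Pz; congr P.
  have [lekn thi _] := ixP i.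
  apply/funext => a; apply/funext => b; apply/funext => c; rewrite /Psi.
  case: eqP => [->|c0]; first by rewrite /shift3 GRing.add0r seed_const.
  by rewrite thi; have [_ ->] := phiP (a, b, c).
(* The elements mapped into P form a subgroup; it contains a lift of every
   element of the free part. *)
have free_part a : exists x, [/\ theta x = a, tau x = 1 & P (Psi x)].
  have closed0 : exists x, [/\ theta x = 0%R, tau x = 1 & P (Psi x)].
    have [j ltjk [thj tauj]] := y_onto 1.
    by exists (z j); split=> //; rewrite Psi_slab //;
      apply: (mem_slab_seed Pgrp Pz).
  have closedD b c : (exists x, [/\ theta x = b, tau x = 1 & P (Psi x)]) ->
      (exists x, [/\ theta x = c, tau x = 1 & P (Psi x)]) ->
      exists x, [/\ theta x = (b + c)%R, tau x = 1 & P (Psi x)].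
    move=> [x [<- taux Px]] [y [<- tauy Py]].
    by exists (x * y); rewrite thetaM tauM taux tauy mulg1; split=> //;
      apply: PPsiM.
  have closedN b : (exists x, [/\ theta x = b, tau x = 1 & P (Psi x)]) ->
      exists x, [/\ theta x = (- b)%R, tau x = 1 & P (Psi x)].
    move=> [x [<- taux Px]].
    by exists x^-1; rewrite thetaV tauV taux invg1; split=> //; apply: PPsiV.
  rewrite -(freeg_sumE a); elim/big_ind: _ => // i _.
  rewrite -[coeff i a]ssrint.intz -freegU_mulz.
  have closed_gen : exists x,
      [/\ theta x = << 1%R *g i >>, tau x = 1 & P (Psi x)].
    by exists (z (ix i)); have [_ ? ?] := ixP i.
  elim/int_rect: (coeff i a) => [|n IHn|n IHn].
  - by rewrite ssrint.mulr0z.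
  - by rewrite ssrint.intS ssrint.mulrzDr; apply: closedD.
  by rewrite ssrint.intS GRing.opprD ssrint.mulrzDr ssrint.mulrNz;
    apply: closedD => //; apply: closedN.
exists Psi; split=> [x y a b c|x|x]; first by rewrite PsiM.
  by rewrite /Psi eqxx.
(* Removing from x a lift of its free part and one of its finite part leaves an
   element of the derived subgroup. *)
have [y [thy tauy Py]] := free_part (theta x).
have [j ltjk [thj tauj]] := y_onto (tau x).
pose d := (y * z j)^-1 * x.
have -> : x = y * z j * d by rewrite mulVKg.
have thd : theta d = 0%R.
  by rewrite thetaM thetaV thetaM thy thj GRing.addr0 GRing.addNr.
apply: (PPsiM (y * z j) d); first apply: PPsiM => //.
  by rewrite Psi_slab //; apply: (mem_slab_seed Pgrp Pz).
rewrite Psi_slab //; apply: (mem_slab_derived Pgrp Pz) => //.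
by apply: ker => //; rewrite tauM tauV tauM tauy tauj mul1g mulVg.
Qed.

End Lattice.

(** * Passage to the wreath product *)

Section Wreath.
Local Open Scope group_scope.
Variable G : groupType.

Definition base_of (u : int -> int -> int -> G) : wreath G Z3 :=
  wr_in_base (fun v : Z3 =>
    u ((v : 'rV[int]_3) 0 0)%R ((v : 'rV[int]_3) 0 1)%R
      ((v : 'rV[int]_3) 0 2)%R).

Lemma base_ofM u v :
  base_of (fun a b c => u a b c * v a b c) = base_of u * base_of v.
Proof. exact: wr_in_baseM. Qed.

Lemma base_ofV u : base_of (fun a b c => (u a b c)^-1) = (base_of u)^-1.
Proof.
apply: (mulgI (base_of u)); rewrite mulgV -base_ofM.
by congr Wreath; apply/funext => v; rewrite mulgV.
Qed.

Definition axis (i : 'I_3) : Z3 := (delta_mx 0 i : 'rV[int]_3)%R.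

(** The three unit translations generate all translations. *)
Lemma subgroup_wr_in_top (H : set (wreath G Z3)) :
  is_subgroup H -> (forall i, H (wr_in_top G (axis i))) ->
  forall v, H (wr_in_top G v).
Proof.
move=> /is_subgroupP[H1 HM HV] Haxis.
pose top (v : 'rV[int]_3) : wreath G Z3 := wr_in_top G (v : Z3).
have topM v w : top (v + w)%R = top v * top w by exact: (@wr_in_topM G Z3 v w).
have HtM v w : H (top v) -> H (top w) -> H (top (v + w)%R).
  by move=> Hv Hw; rewrite topM; apply: HM.
have HtV v : H (top v) -> H (top (- v)%R).
  move=> /HV; congr H; apply: (mulgI (top v)).
  by rewrite -topM GRing.subrr mulgV.
have Ht1 : H (top 0%R) by exact: H1.
move=> v; change (H (top v)); rewrite [v]matrix_sum_delta big_ord1.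
elim/big_ind: _ => // i _.
rewrite -[X in (X *: _)%R]ssrint.intz ssrint.scaler_int.
elim/int_rect: ((v : 'rV[int]_3) _ i) => [//|n IHn|n IHn].
  by rewrite ssrint.intS ssrint.mulrzDr; apply: HtM => //; apply: Haxis.
rewrite ssrint.intS GRing.opprD ssrint.mulrzDr ssrint.mulrNz.
by apply: HtM => //; apply: HtV; apply: Haxis.
Qed.

(** Conjugation by an element of Z^3 translates functions. *)
Lemma shift_invariant_base (H : set (wreath G Z3)) :
  is_subgroup H -> (forall i, H (wr_in_top G (axis i))) ->
  shift_invariant_group (fun u => H (base_of u)).
Proof.
move=> Hgrp /(subgroup_wr_in_top Hgrp) Htop.
have /is_subgroupP[_ HM HV] := Hgrp.
split=> [u v Hu Hv|u Hu|u i j k Hu].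
- by rewrite base_ofM; apply: HM.
- by rewrite base_ofV; apply: HV.
pose t : Z3 := (\row_l nth 0 [:: i; j; k] l)%R.
have := HM _ _ (HM _ _ (HV _ (Htop t)) Hu) (Htop t).
rewrite wr_conj; congr (H (wr_in_base _)).
apply/funext => v.
by congr u; rewrite [LHS]mxE mxE /= GRing.addrC.
Qed.

End Wreath.

Lemma countable_enumeration (G : groupType) :
  countable [set: G]%classic ->
  exists g : nat -> G, forall x, exists n, g n = x.
Proof.
move=> /countable_injP[code code_inj].
exists (fun n => xget 1%g [set x | code x = n]%classic) => x; exists (code x).
apply: code_inj; rewrite ?inE //.
exact: (@xgetPex _ 1%g [set y | code y = code x]%classic
  (ex_intro _ x erefl)).
Qed.

Theorem theorem3 (G : groupType)
    (G_countable : countable [set: G]%classic)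
    (G_ab : exists (A : groupType) (F : finGroupType),
       free_abelian A /\ isomorphic (abelianization G) (A * F)%type) :
  exists H : set (wreath G Z3),
    [/\ is_subgroup H, generated_by_k 4 H & embeds_in G H].
Proof.
have [A [F [[K [hA hA_bij]] [hG hG_bij]]]] := G_ab.
have [hG' hGK hG'K] := hG_bij; have [hA' hAK hA'K] := hA_bij.
pose theta (x : G) : {freeg K} := hA (hG (ab_pi x)).1.
pose tau (x : G) : F := (hG (ab_pi x)).2.
have hAM (u v : A) : hA (u * v)%g = (hA u * hA v)%g by rewrite gmulfM.
have hGM u v : hG (u * v)%g = ((hG u).1 * (hG v).1, (hG u).2 * (hG v).2)%g.
  by rewrite gmulfM.
have thetaM x y : theta (x * y)%g = (theta x + theta y)%R.
  by rewrite /theta ab_piM hGM /= hAM.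
have tauM x y : tau (x * y)%g = (tau x * tau y)%g.
  by rewrite /tau ab_piM hGM.
have onto a e : exists x, theta x = a /\ tau x = e.
  have [x pix] := ab_pi_surj (hG' (hA' a, e)).
  by exists x; rewrite /theta /tau pix hG'K hA'K.
have theta1 : theta 1%g = 0%R.
  by apply: (GRing.addrI (theta 1%g)); rewrite -thetaM mulg1 GRing.addr0.
have tau1 : tau 1%g = 1%g.
  by apply: (mulgI (tau 1%g)); rewrite -tauM !mulg1.
have ker x : theta x = 0%R -> tau x = 1%g -> derived x.
  rewrite -theta1 -tau1 => /(can_inj hAK) fst_x snd_x.
  apply/ab_pi_ker; apply: (can_inj hGK).
  by rewrite [LHS]surjective_pairing [RHS]surjective_pairing fst_x; congr pair.
have [g g_onto] := countable_enumeration G_countable.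
have /choice[y yP] := onto 0%R.
pose k := #|F|.
pose z n := if n < k then y (nth 1%g (enum F) n) else g (n - k).
pose gens : 4.-tuple (wreath G Z3) := [tuple base_of (seed k z);
  wr_in_top G (axis 0%R); wr_in_top G (axis 1%R); wr_in_top G (axis 2%R)].
pose H : set (wreath G Z3) := Defs.generated [set` gens]%classic.
have Hgrp : is_subgroup H := @generated_subgroup _ _.
have Hgen w : w \in gens -> H w by move=> gens_w H' [_]; apply.
have Hseed : H (base_of (seed k z)) by apply: Hgen; rewrite /= !inE eqxx.
have Haxis i : H (wr_in_top G (axis i)).
  apply: Hgen; rewrite /= !inE.
  by case: i => [[|[|[|//]]] i3]; apply/or4P; constructor; apply/eqP;
     congr (wr_in_top G (axis _)); apply: val_inj.
have Pgrp := shift_invariant_base Hgrp Haxis.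
have [|e|i|Psi [PsiM Psi0 PPsi]] :=
  shift_invariant_embedding Pgrp Hseed _ _ thetaM tauM _ ker.
- move=> x; have [n <-] := g_onto x.
  by exists (k + n); rewrite /z ?leq_addr // ltnNge leq_addr addKn.
- have lte : index e (enum F) < k by rewrite /k cardE index_mem mem_enum.
  by exists (index e (enum F)); rewrite // /z lte nth_index ?mem_enum.
- exact: onto.
pose f (x : G) := base_of (Psi x).
have fM : {morph f : x y / (x * y)%g}.
  move=> x y'; rewrite /f -base_ofM; congr base_of.
  by apply/funext => a; apply/funext => b; apply/funext => c.
pose fm := isMultiplicative.Build G (wreath G Z3) f fM.
pose F' : {multiplicative G -> wreath G Z3} := HB.pack f fm.
exists H; split=> //; first by eexists.
exists F'; split=> [x x'
    /(congr1 (fun w => wr_fun w ((0%R : 'rV[int]_3) : Z3)))|].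
  by rewrite /= !mxE !Psi0.
by move=> _ [x _ <-]; apply: PPsi.
Qed.
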